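(* Let $0<s\leq k\leq n$ be positive integers. Let $L=\{\ell_1,\ldots,\ell_s\}$ be a set of $s$ positive integers such that $0<\ell_1<\ldots<\ell_s$. Suppose that $n> \binom{k^2}{\ell_1+1}s+\ell_1$. Let $\mathcal{G}=\{G_1,\ldots,G_m\}$ be an $L$-intersecting, $k$-uniform family of subsets of $[n]$. Suppose that $$ |\mathcal{G}|=\binom{n-\ell_1}{s}. $$ Then there exists a subset $T\subseteq [n]$ with $|T|=\ell_1$ such that $T\subseteq G$ for each $G\in\mathcal{G}$.
   Context: $[n]=\{1,2,\ldots,n\}$. A family $\mathcal{G}$ is a set of (distinct) subsets of $[n]$. A family $\mathcal{G}$ is $k$-uniform if $|G|=k$ for each $G\in\mathcal{G}$. For a set $L$ of nonnegative integers, a family $\mathcal{G}$ is $L$-intersecting if $|E\cap F|\in L$ for every pair $E,F$ of distinct members of $\mathcal{G}$.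
   Formalization: The formal statement adds the hypothesis ℓ_1 ≤ k; without it the claim fails, e.g. n=6, k=s=1, L={5}, G={{x}}, where |G|=1=C(1,1) but no 5-element T lies in {x}. *)

(* Defs.v *)
From mathcomp Require Import all_boot.

Set Implicit Arguments.
Unset Strict Implicit.
Unset Printing Implicit Defensive.

(* The ground set [n] = {1, ..., n} is rendered by the n-element type 'I_n, and
   a family of subsets of [n] by an element of {set {set 'I_n}}. *)

Definition uniform (n k : nat) (G : {set {set 'I_n}}) : Prop :=
  forall E : {set 'I_n}, E \in G -> #|E| = k.

Definition intersecting (n : nat) (L : seq nat) (G : {set {set 'I_n}}) : Prop :=
  forall E F : {set 'I_n},
    E \in G -> F \in G -> E != F -> #|E :&: F| \in L.

(* Main.v *)
Require Import Defs.
From mathcomp Require Import all_boot.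
From mathcomp Require Import all_order all_algebra zify.

Set Implicit Arguments.
Unset Strict Implicit.
Unset Printing Implicit Defensive.

Import Order.TTheory GRing.Theory Num.Theory.

(** Write l for the least element of L. Suppose that no l-set lies in every
    member of G. If l < k, there is a set M with at most k ^ 2 points that meets
    every member in more than l points (common_or_transversal): any member A
    will do unless some member B meets A in exactly l points, and then
    M = A u B u C works for a member C that does not contain the intersection
    of A and B. Hence every member contains some (l + 1)-subset U of M.

    For a fixed U, the members containing U have pairwise intersections of
    size > l, so only s - 1 sizes remain. Deleting U and applying the
    Ray-Chaudhuri--Wilson theorem bounds their number by
    'C(n - l - 1, s - 1) (link_bound). Summing over U,
      #|G| <= 'C(k ^ 2, l + 1) * 'C(n - l - 1, s - 1),
    whereas 'C(n - l, s) = (n - l) / s * 'C(n - l - 1, s - 1), and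
    (n - l) / s > 'C(k ^ 2, l + 1) by the lower bound on n: a contradiction.
    If l = k, two distinct members would share k points, so G has at most one
    member.

    The Ray-Chaudhuri--Wilson theorem bounds a k-uniform family F of subsets of
    X whose pairwise intersection sizes lie in a list L of s <= k values, all
    less than k. It is proved by linear algebra over the rationals. For B in F,
    the function A |-> \prod_(l in L) (|B n A| - l) is, on F, a nonzero multiple
    of the point mass at B. It is also a combination of the 'C(|X|, s) indicators
    [J \subset A] with |J| = s, because on k-sets each factor |B n A| - l
    raises the degree of such an indicator by exactly one (degree_raise).
    The |F| point masses are linearly independent, so |F| <= 'C(|X|, s). *)

(** * The Ray-Chaudhuri--Wilson theorem *)

Section RayChaudhuriWilson.
Local Open Scope ring_scope.

Variables (T : finType) (F : {set {set T}}) (X : {set T}) (k : nat).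
Hypothesis FX : forall A, A \in F -> A \subset X.
Hypothesis Fk : forall A, A \in F -> #|A| = k.

(** Functions on F are extended by zero to all sets: two combinations are equal
    as soon as they agree on F. *)
Definition chi (J : {set T}) : {ffun {set T} -> rat^o} :=
  [ffun A => ((A \in F) && (J \subset A))%:R].

Definition inclusion_space (j : nat) : {vspace {ffun {set T} -> rat^o}} :=
  <<[seq chi J | J <- enum [set J : {set T} | (J \subset X) && (#|J| == j)]]>>%VS.

Lemma dim_inclusion_space j : (\dim (inclusion_space j) <= 'C(#|X|, j))%N.
Proof. by rewrite (leq_trans (dim_span _)) // size_map -cardE cards_draws. Qed.

Lemma mem_chi (J : {set T}) : chi J \in inclusion_space #|J|.
Proof.
have [JX | nJX] := boolP (J \subset X).
  by apply: memv_span; apply: map_f; rewrite mem_enum inE JX eqxx.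
suff -> : chi J = 0 by apply: mem0v.
apply/ffunP=> A; rewrite !ffunE; case: (boolP (A \in F)) => //= AF.
by case: (boolP (J \subset A)) => // /subset_trans/(_ (FX AF)); rewrite (negPf nJX).
Qed.

Lemma sum_chi_setU1 (J D A : {set T}) : A \in F ->
  \sum_(x in D :\: J) chi (x |: J) A = #|D :&: A :\: J|%:R * chi J A.
Proof.
move=> AF; rewrite ffunE AF /=.
under eq_bigr => x _ do rewrite ffunE AF /= subUset sub1set.
case: (J \subset A); last by rewrite mulr0 big1 // => x _; rewrite andbF.
under eq_bigr => x _ do rewrite andbT.
rewrite mulr1 -sum1_card natr_sum [RHS]big_mkcond [LHS]big_mkcond /=.
apply: eq_bigr => x _; rewrite !inE.
by case: (x \in J); case: (x \in D); case: (x \in A).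
Qed.

(** Split |B n A| as |B n J| plus the points of B n A outside J. For J inside A,
    the latter are counted by the x in B \ J with x |: J inside A; the constant
    |B n J| - l is itself a combination of the same indicators, since exactly
    k - |J| points x outside J satisfy x |: J \subset A. This last point is
    where uniformity enters: it avoids any term of lower degree. *)
Lemma degree_raise (B J A : {set T}) (l : nat) : A \in F -> (#|J| < k)%N ->
  (#|B :&: A|%:R - l%:R) * chi J A =
  \sum_(x in ~: J) ((x \in B)%:R + (#|B :&: J|%:R - l%:R) / (k - #|J|)%:R)
     * chi (x |: J) A.
Proof.
move=> AF Jk.
have kJ0 : (k - #|J|)%:R != 0 :> rat by rewrite pnatr_eq0 -lt0n subn_gt0.
under eq_bigr => x _ do rewrite mulrDl.
rewrite big_split /= -mulr_sumr.
have -> : \sum_(x in ~: J) (x \in B)%:R * chi (x |: J) A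
          = #|B :&: A :\: J|%:R * chi J A.
  rewrite -sum_chi_setU1 // [RHS]big_mkcond [LHS]big_mkcond /=.
  apply: eq_bigr => x _; rewrite !inE.
  by case: (x \in J); case: (x \in B); rewrite ?mul1r ?mul0r.
rewrite -setTD sum_chi_setU1 // setTI.
have [JA | nJA] := boolP (J \subset A); last first.
  by rewrite [chi J A]ffunE (negPf nJA) andbF !mulr0 addr0.
rewrite mulrA -mulrDl; congr (_ * _).
have -> : #|A :\: J| = (k - #|J|)%N.
  by rewrite cardsD (setIidPr JA) Fk.
rewrite divfK // -(cardsID J (B :&: A)) natrD.
by rewrite -setIA (setIidPr JA) addrCA addrA.
Qed.

Lemma mem_prod_chi (B : {set T}) (L : seq nat) (J : {set T}) :
  (#|J| + size L <= k)%N ->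
  [ffun A => (\prod_(l <- L) (#|B :&: A|%:R - l%:R)) * chi J A]
    \in inclusion_space (#|J| + size L).
Proof.
elim: L J => [|l L IH] J /=.
  move=> _; rewrite addn0; set f := finfun _.
  suff -> : f = chi J by apply: mem_chi.
  by apply/ffunP=> A; rewrite [LHS]ffunE big_nil mul1r.
rewrite addnS => Hk.
have Jk : (#|J| < k)%N by apply: leq_ltn_trans Hk; rewrite leq_addr.
pose c x : rat := (x \in B)%:R + (#|B :&: J|%:R - l%:R) / (k - #|J|)%:R.
suff -> : [ffun A => (\prod_(l <- l :: L) (#|B :&: A|%:R - l%:R)) * chi J A] =
  \sum_(x in ~: J) c x *:
    [ffun A => (\prod_(l <- L) (#|B :&: A|%:R - l%:R)) * chi (x |: J) A].
  apply: memv_suml => x; rewrite inE => xJ; apply: rpredZ.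
  have cJ : #|x |: J| = #|J|.+1 by rewrite cardsU1 xJ.
  by have := IH (x |: J); rewrite cJ addSn; apply.
apply/ffunP=> A; rewrite ffunE sum_ffunE big_cons.
case: (boolP (A \in F)) => AF; last first.
  rewrite [chi J A]ffunE (negPf AF) mulr0 big1 // => x _.
  by rewrite !ffunE (negPf AF) /= mulr0 scaler0.
rewrite mulrAC degree_raise // mulr_suml; apply: eq_bigr => x _.
by rewrite [RHS]ffunE [in RHS]ffunE -mulrA; congr (_ * _); rewrite mulrC.
Qed.

(** The bound is a dimension count: the space generated by the inclusion
    functions of degree size L contains the point mass at each member of F. *)
Lemma ray_chaudhuri_wilson (L : seq nat) :
  (size L <= k)%N -> (forall l, l \in L -> (l < k)%N) ->
  (forall A B, A \in F -> B \in F -> A != B -> #|A :&: B| \in L) ->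
  (#|F| <= 'C(#|X|, size L))%N.
Proof.
move=> sk Lk FL.
apply: leq_trans (dim_inclusion_space _).
pose point_mass (i : 'I_#|F|) : {ffun {set T} -> rat^o} :=
  [ffun A => (A == enum_val i)%:R].
pose masses := [tuple point_mass i | i < #|F|].
have free_masses : free masses.
  apply/freeP => c c0 i.
  have := congr1 (fun f : {ffun _ -> _} => f (enum_val i)) c0.
  rewrite sum_ffunE ffunE (bigD1 i) //= big1 ?addr0 => [|j ji].
    by rewrite (nth_map i) ?size_enum_ord // nth_ord_enum !ffunE eqxx [_ *: _]mulr1.
  rewrite (nth_map i) ?size_enum_ord // nth_ord_enum !ffunE.
  by rewrite (inj_eq enum_val_inj) eq_sym (negPf ji) scaler0.
have <- : size masses = #|F| by rewrite size_tuple.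
rewrite -(eqP free_masses); apply: dimvS; apply/span_subvP => _ /mapP[i _ ->].
set B := enum_val i; have BF : B \in F := enum_valP i.
have p0 : \prod_(l <- L) (k%:R - l%:R) != 0 :> rat.
  rewrite prodf_seq_neq0; apply/allP => l lL; rewrite /= subr_eq0 eqr_nat.
  by rewrite gtn_eqF ?Lk.
(* J = set0 makes chi J the indicator of F, so the product itself is in the space. *)
have := @mem_prod_chi B L set0; rewrite cards0 => /(_ sk).
move/(memvZ (\prod_(l <- L) (k%:R - l%:R))^-1).
set f := (_ *: _); suff -> : point_mass i = f by [].
apply/ffunP=> A; rewrite {}/f !ffunE sub0set andbT.
have [-> | nAB] := eqVneq A B.
  by rewrite BF mulr1 setIid Fk // [_ *: _]mulVf.
have [AF | _] := boolP (A \in F); last by rewrite mulr0 scaler0.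
suff -> : \prod_(l <- L) (#|B :&: A|%:R - l%:R) = 0 :> rat by rewrite mul0r scaler0.
by rewrite (big_rem #|B :&: A|) /= ?subrr ?mul0r // setIC FL.
Qed.
End RayChaudhuriWilson.

(** * Links and transversals *)

Lemma leq_bin_below_half n i j : i <= j -> j.*2 <= n -> 'C(n, i) <= 'C(n, j).
Proof.
elim: j => [|j IH]; first by rewrite leqn0 => /eqP->.
rewrite leq_eqVlt ltnS => /predU1P[-> // | le_ij] jn.
have le_jn : j < n - j by lia.
apply: leq_trans (IH le_ij ltac:(lia)) _.
rewrite -(leq_pmul2l (ltn0Sn j)) mul_bin_left.
by rewrite leq_mul2r le_jn orbT.
Qed.

(** Removing U turns these sets into a uniform family on the complement of U,
    with the intersection sizes shifted down by #|U|. Some sizes in L may be at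
    least k and then never occur; the theorem is applied to the others, and the
    resulting binomial is at most that of size L, because
    size L is at most half of the number of remaining points. *)
Lemma link_bound (T : finType) (G : {set {set T}}) (U : {set T}) (k : nat)
    (L : seq nat) :
  uniq L -> (forall l, l \in L -> #|U| <= l) ->
  (size L).*2 <= #|T| - #|U| ->
  (forall E, E \in G -> U \subset E) ->
  (forall E, E \in G -> #|E| = k) ->
  (forall E F, E \in G -> F \in G -> E != F -> #|E :&: F| \in L) ->
  #|G| <= 'C(#|T| - #|U|, size L).
Proof.
move=> Luniq UL Lsmall GU Gk GL.
(* Distinct values below k - #|U|, hence at most k - #|U| of them. *)
pose L' := [seq l - #|U| | l <- L & l < k].
have L'k l : l \in L' -> l < k - #|U|.
  case/mapP => m; rewrite mem_filter => /andP[mk mL] ->.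
  by have := UL m mL; lia.
have sL' : size L' <= k - #|U|.
  rewrite -(size_iota 0 (k - #|U|)); apply: uniq_leq_size; last first.
    by move=> l /L'k; rewrite mem_iota.
  rewrite map_inj_in_uniq ?filter_uniq // => x y.
  rewrite !mem_filter => /andP[_ /UL xU] /andP[_ /UL yU]; lia.
have link_inj : {in G &, injective (fun E => E :\: U)}.
  move=> E F /GU UE /GU UF EF.
  by rewrite -(setID E U) -(setID F U) EF (setIidPr UE) (setIidPr UF).
rewrite -(card_in_imset link_inj).
apply: leq_trans (_ : 'C(#|~: U|, size L') <= _); last first.
  rewrite cardsCs setCK; apply: leq_bin_below_half => //.
  by rewrite size_map size_filter count_size.
apply: (@ray_chaudhuri_wilson _ _ _ (k - #|U|)) => //.
- by move=> _ /imsetP[E _ ->]; rewrite setDE subsetIr.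
- move=> _ /imsetP[E EG ->].
  by rewrite cardsD (setIidPr (GU _ EG)) Gk.
move=> _ _ /imsetP[E EG ->] /imsetP[F FG ->] neEF.
have EF : E != F by apply: contraNneq neEF => ->.
have UEF : U \subset E :&: F by rewrite subsetI !GU.
have -> : #|(E :\: U) :&: (F :\: U)| = #|E :&: F| - #|U|.
  by rewrite -setDIl cardsD (setIidPr UEF).
apply: map_f; rewrite mem_filter GL // andbT -(Gk E EG) proper_card //.
rewrite properEneq subsetIl andbT; apply: contraNneq EF => /setIidPl sEF.
by rewrite eqEcard sEF (Gk E EG) (Gk F FG) leqnn.
Qed.

(** Take A, B in G meeting in an l-set S, and C in G not containing S. If some E
    in G met M = A u B u C in l points or fewer, then E would have the same
    trace on A, B, C and M, because each of the first three traces already has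
    l points. That trace lies in A n B and has l points, so it equals S, and
    it lies in C: a contradiction. *)
Lemma common_or_transversal (T : finType) (G : {set {set T}}) (k l : nat) :
  0 < l < k ->
  (forall E, E \in G -> #|E| = k) ->
  (forall E F, E \in G -> F \in G -> E != F -> l <= #|E :&: F|) ->
  (exists2 S : {set T}, #|S| = l & forall E, E \in G -> S \subset E) \/
  (exists2 M : {set T}, #|M| <= k ^ 2 & forall E, E \in G -> l < #|E :&: M|).
Proof.
move=> /andP[l0 lk] Gk Gl.
have Gl' E F : E \in G -> F \in G -> l <= #|E :&: F|.
  move=> EG FG; have [-> | EF] := eqVneq E F; last exact: Gl.
  by rewrite setIid (Gk F FG) ltnW.
have [-> | [A AG]] := set_0Vmem G.
  by right; exists set0 => [|E]; rewrite ?cards0 ?inE.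
have [/forall_inP lA | ] := boolP [forall E in G, l < #|E :&: A|].
  right; exists A => //; rewrite (Gk A AG); nia.
rewrite negb_forall_in => /exists_inP[B BG]; rewrite -leqNgt => lAB.
have cS : #|B :&: A| = l by apply/eqP; rewrite eqn_leq lAB Gl'.
have [/forall_inP SG | ] := boolP [forall E in G, B :&: A \subset E].
  by left; exists (B :&: A).
rewrite negb_forall_in => /exists_inP[C CG nSC].
right; exists (A :|: B :|: C) => [|E EG].
  have := cardsUI A B; have := cardsUI (A :|: B) C.
  have : 0 < #|(A :|: B) :&: C|.
    apply: leq_trans l0 (leq_trans (Gl' _ _ AG CG) _).
    by rewrite subset_leq_card // setSI // subsetUl.
  (* A u B has 2k - l points and C adds at most k - l, with l > 0 and k > 1;
     and 3k - 2 <= k ^ 2. *)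
  rewrite (setIC A B) cS (Gk A) // (Gk B) // (Gk C) // expnS expn1; nia.
rewrite ltnNge; apply: contra nSC => small.
have trace D : D \in G -> D \subset A :|: B :|: C -> E :&: D = E :&: (A :|: B :|: C).
  move=> DG sD; apply/eqP; rewrite eqEcard setIS //=.
  exact: leq_trans small (Gl' _ _ EG DG).
have EA : E :&: A = E :&: (A :|: B :|: C).
  by apply: trace => //; rewrite -setUA subsetUl.
have EB : E :&: B = E :&: (A :|: B :|: C).
  by apply: trace => //; rewrite setUAC subsetUr.
have EC : E :&: C = E :&: (A :|: B :|: C).
  by apply: trace => //; rewrite subsetUr.
have -> : B :&: A = E :&: C.
  rewrite EC; apply/eqP; rewrite eq_sym eqEcard cS -{2}EA Gl' // andbT.
  by rewrite subsetI -{1}EB -EA !subsetIr.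
exact: subsetIr.
Qed.

Lemma cover_bound (T : finType) (G : {set {set T}}) (M : {set T}) (u b : nat) :
  (forall E, E \in G -> u <= #|E :&: M|) ->
  (forall U : {set T}, #|U| = u -> #|[set E in G | U \subset E]| <= b) ->
  #|G| <= 'C(#|M|, u) * b.
Proof.
move=> GM Ub.
pose K := [set U : {set T} | U \subset M & #|U| == u].
have /subset_leq_card sG : G \subset \bigcup_(U in K) [set E in G | U \subset E].
  apply/subsetP=> E EG; have := GM E EG.
  rewrite -bin_gt0 -cards_draws card_gt0 => /set0Pn[U].
  rewrite inE subsetI => /andP[/andP[UE UM] cU].
  by apply/bigcupP; exists U; rewrite !inE ?UM ?EG.
apply: leq_trans sG _; rewrite -cards_draws -sum_nat_const.
elim/big_ind2: _ => [|V v W w Vv Ww|U]; first by rewrite cards0.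
  by rewrite (leq_trans (leq_card_setU _ _)) ?leq_add.
by rewrite inE => /andP[_ /eqP /Ub].
Qed.

(** * The main result *)

Theorem corollary1p11 (n k s : nat) (L : s.-tuple nat) (G : {set {set 'I_n}})
  (s_gt0 : 0 < s) (le_sk : s <= k) (le_kn : k <= n)
  (L_incr : sorted ltn L) (l1_gt0 : 0 < head 0 L)
  (l1_le_k : head 0 L <= k)
  (n_large : 'C(k ^ 2, (head 0 L).+1) * s + head 0 L < n)
  (G_uniform : uniform k G) (G_intersecting : intersecting L G)
  (G_card : #|G| = 'C(n - head 0 L, s)) :
  exists T : {set 'I_n},
    #|T| = head 0 L /\ (forall E : {set 'I_n}, E \in G -> T \subset E).
Proof.
case: L L_incr l1_gt0 l1_le_k n_large G_intersecting G_card => -[|l L] /= sizeL.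
  by rewrite -(eqP sizeL) in s_gt0.
move=> L_incr l_gt0 l_le_k n_large G_intersecting G_card.
have sE : s = (size L).+1 by rewrite -(eqP sizeL).
have lL m : m \in L -> l < m.
  by move: m; apply/allP; apply: order_path_min L_incr; apply: ltn_trans.
have l_leL m : m \in l :: L -> l <= m.
  by rewrite inE => /predU1P[-> // | /lL /ltnW].
have [l_eq_k | l_lt_k] := leqP k l.
  have {l_eq_k l_le_k} lk : l = k by apply/eqP; rewrite eqn_leq l_le_k.
  have [G0 | [E EG]] := set_0Vmem G.
    have : 0 < 'C(#|[set: 'I_n]|, k) by rewrite cardsT card_ord bin_gt0.
    rewrite -cards_draws card_gt0 => /set0Pn[S]; rewrite inE => /andP[_ /eqP cS].
    by exists S; rewrite cS lk; split=> // E; rewrite G0 inE.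
  exists E; split=> [|F FG]; first by rewrite (G_uniform E EG) lk.
  have [-> // | EF] := eqVneq E F.
  have := l_leL _ (G_intersecting E F EG FG EF).
  rewrite lk -(G_uniform E EG) => cEF.
  by apply/setIidPl/eqP; rewrite eqEcard subsetIl.
have Gl E F : E \in G -> F \in G -> E != F -> l <= #|E :&: F|.
  by move=> EG FG EF; apply: l_leL; apply: G_intersecting.
have l_between : 0 < l < k by rewrite l_gt0.
have [[S cS SG]|[M cM GM]] := common_or_transversal l_between G_uniform Gl.
  by exists S.
exfalso.
(* This makes n large enough for the half-size condition of link_bound. *)
have bin_gt1 : 1 < 'C(k ^ 2, l.+1).
  have -> : k ^ 2 = (k ^ 2).-1.+1 by rewrite prednK //; nia.
  rewrite binS -addn1 addnC leq_add // bin_gt0; nia.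
have link (U : {set 'I_n}) : #|U| = l.+1 -> #|[set E in G | U \subset E]| <= 'C(n - l.+1, size L).
  move=> cU; have := @link_bound _ [set E in G | U \subset E] U k L.
  rewrite card_ord cU; apply.
  - by have /andP[_] := sorted_uniq ltn_trans ltnn (L_incr : sorted ltn (l :: L)).
  - exact: lL.
  - nia.
  - by move=> E; rewrite inE => /andP[].
  - by move=> E; rewrite inE => /andP[/G_uniform].
  move=> E F; rewrite !inE => /andP[EG UE] /andP[FG UF] EF.
  have := G_intersecting E F EG FG EF; rewrite inE => /predU1P[cEF | //].
  have : #|U| <= #|E :&: F| by rewrite subset_leq_card // subsetI UE.
  by rewrite cU cEF ltnn.
have G_le := cover_bound GM link.
have {G_le} G_le : #|G| <= 'C(k ^ 2, l.+1) * 'C(n - l.+1, size L).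
  by apply: leq_trans G_le _; rewrite leq_mul2r leq_bin2l ?orbT.
have link_gt0 : 0 < 'C(n - l.+1, size L) by rewrite bin_gt0; nia.
have := mul_bin_diag (n - l) (size L); rewrite -subnS -sE -G_card => countE.
have : (n - l) * 'C(n - l.+1, size L) <= s * 'C(k ^ 2, l.+1) * 'C(n - l.+1, size L).
  by rewrite countE -mulnA leq_mul2l G_le orbT.
rewrite leq_pmul2r // mulnC leq_subLR addnC leqNgt.
by rewrite n_large.
Qed.
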